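(* Let $A^\star\in\mathbb{R}^{n\times n}$, $B^\star\in\mathbb{R}^{n\times m}$, $C^\star\in\mathbb{R}^{p\times n}$ with $(A^\star,C^\star)$ observable, and let $\ell^\star$ be the observability index of $(A^\star,C^\star)$. Let data $\{u^{\mathrm m}(k),y^{\mathrm m}(k)\}_{k=0}^T$ (with $T\ge \ell^\star$) be generated as described in the context, let $\Psi_0,\Psi_1,\Theta,\Theta_{11},\Theta_{12},\Theta_{22},\mathscr{A},\mathscr{B},\mathscr{C},\mathbf{F}_{\ell^\star},\mathbf{L}_{\ell^\star},\mathbf{B}_{\ell^\star}$ be as defined in the context, assume the noise matrix satisfies $\Delta_{10}\Delta_{10}^\top\preceq\Theta$ and assume $\Psi_0\Psi_0^\top\succ\Theta_{22}$. Suppose there exist $\mathbf{Y}\in\mathbb{R}^{m\times(p\ell^\star+m\ell^\star)}$ and $P=P^\top\succ0$ such that $$\begin{bmatrix}-P-\mathbf{L}_{\ell^\star}\mathscr{C}\mathbf{L}_{\ell^\star}^\top & \mathbf{F}_{\ell^\star}P+\mathbf{B}_{\ell^\star}\mathbf{Y} & \mathbf{L}_{\ell^\star}\mathscr{B}\\ P\mathbf{F}_{\ell^\star}^\top+\mathbf{Y}^\top\mathbf{B}_{\ell^\star}^\top & -P & -P\\ \mathscr{B}^\top\mathbf{L}_{\ell^\star}^\top & -P & -\mathscr{A}\end{bmatrix}\prec0,$$ and let $\mathbf{K}=\mathbf{Y}P^{-1}$. Then $(x,\chi)=0$ is globally asymptotically stable for the feedback interconnection of the plant $x^+=A^\star x+B^\star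 u$, $y=C^\star x$ and the controller $\chi^+=(\mathbf{F}_{\ell^\star}+\mathbf{B}_{\ell^\star}\mathbf{K})\chi+\mathbf{L}_{\ell^\star}y$, $u=\mathbf{K}\chi$. Moreover, along every solution of this interconnection, for each $k\ge\ell^\star$, $\chi(k)=(y(k-\ell^\star),\dots,y(k-1),u(k-\ell^\star),\dots,u(k-1))$.
   Context: Notation: $(v_1,\dots,v_r)$ denotes the stacked column vector; $M\succ0$ ($\succeq0$) means positive (semi)definite. The observability index of an observable pair $(A,C)$ is the smallest $l$ with $\operatorname{rank}[C;CA;\dots;CA^{l-1}]=n$. Auxiliary matrices for $\ell=\ell^\star$: $\mathbf{F}_\ell=\mathrm{blockdiag}(S_p,S_m)$ where $S_q\in\mathbb{R}^{q\ell\times q\ell}$ has identity blocks $I_q$ on the first block superdiagonal (block $(i,i+1)$, $i=1,\dots,\ell-1$) and zeros elsewhere; $\mathbf{L}_\ell\in\mathbb{R}^{(p\ell+m\ell)\times p}$ has $I_p$ in its rows $p\ell-p+1,\dots,p\ell$ and zeros elsewhere; $\mathbf{B}_\ell\in\mathbb{R}^{(p\ell+m\ell)\times m}$ has $I_m$ in its last $m$ rows and zeros elsewhere. Data generation: for $k=0,\dots,T$, $x(k+1)=A^\star x(k)+B^\star u(k)$, $y(k)=C^\star x(k)$, from some initial $x(0)$, with unknown noises $d^u,d^y$ and measured signals $u^{\mathrm m}(k)=u(k)+d^u(k)$, $y^{\mathrm m}(k)=y(k)+d^y(k)$. With $\ell=\ell^\star$, define matrices with $T-\ell+1$ columns indexed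 by $j=0,\dots,T-\ell$: column $j$ of $\Psi_1$ is $(y^{\mathrm m}(j+1),\dots,y^{\mathrm m}(j+\ell),u^{\mathrm m}(j+1),\dots,u^{\mathrm m}(j+\ell))$; column $j$ of $\Psi_0$ is $(y^{\mathrm m}(j),\dots,y^{\mathrm m}(j+\ell-1),u^{\mathrm m}(j),\dots,u^{\mathrm m}(j+\ell-1))$; column $j$ of $\Delta_{10}$ is $(d^y(j+\ell),d^y(j),\dots,d^y(j+\ell-1),d^u(j),\dots,d^u(j+\ell-1))$. $\Theta=\Theta^\top\succeq0$ is a given matrix of size $(p+p\ell+m\ell)$, partitioned as $\Theta=\begin{bmatrix}\Theta_{11}&\Theta_{12}\\\Theta_{12}^\top&\Theta_{22}\end{bmatrix}$ with $\Theta_{11}\in\mathbb{R}^{p\times p}$. Define $\mathscr{A}=\Psi_0\Psi_0^\top-\Theta_{22}$, $\mathscr{B}=-\mathbf{L}_\ell^\top\Psi_1\Psi_0^\top+\Theta_{12}$, $\mathscr{C}=\mathbf{L}_\ell^\top\Psi_1\Psi_1^\top\mathbf{L}_\ell-\Theta_{11}$. *)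

(* Defs.v *)
From HB Require Import structures.
From mathcomp Require Import all_boot all_order all_algebra.
From mathcomp Require Import reals.
Set Implicit Arguments. Unset Strict Implicit. Unset Printing Implicit Defensive.
Import Order.TTheory GRing.Theory Num.Theory.
Local Open Scope ring_scope.

Section Defs.
Variable R : realType.

Definition obs_mx (n p : nat) (C : 'M[R]_(p, n)) (A : 'M[R]_n) (l : nat) :=
  \mxcol_(i < l) (C *m A ^+ i).

Definition observable (n p : nat) (A : 'M[R]_n) (C : 'M[R]_(p, n)) : Prop :=
  exists l, \rank (obs_mx C A l) = n.

Definition obs_index (n p : nat) (A : 'M[R]_n) (C : 'M[R]_(p, n)) (l : nat) : Prop :=
  \rank (obs_mx C A l) = n /\ forall l', (l' < l)%N -> \rank (obs_mx C A l') != n.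

Definition psdmx (N : nat) (M : 'M[R]_N) : Prop :=
  M^T = M /\ forall v : 'cV[R]_N, 0 <= (v^T *m M *m v) 0 0.
Definition pdmx (N : nat) (M : 'M[R]_N) : Prop :=
  M^T = M /\ forall v : 'cV[R]_N, v != 0 -> 0 < (v^T *m M *m v) 0 0.

(* stacked vector (f 0, ..., f (l-1)) of vectors of size q, of size l*q;
   entry i*q+a is (f i) a *)
Definition stack (l q : nat) (f : 'I_l -> 'cV[R]_q) : 'cV[R]_(l * q) :=
  (mxvec (\matrix_(i < l, a < q) f i a 0))^T.

Definition mk_cols (M N : nat) (f : 'I_N -> 'cV[R]_M) : 'M[R]_(M, N) :=
  \matrix_(r < M, j < N) f j r 0.

(* S_q : identity blocks I_q on the first block superdiagonal *)
Definition shift_mx (q l : nat) : 'M[R]_(l * q) :=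
  \matrix_(i < l * q, j < l * q) ((j : nat) == (i + q)%N)%:R.

Definition Fmat (p m l : nat) : 'M[R]_(l * p + l * m) :=
  block_mx (shift_mx p l) 0 0 (shift_mx m l).

Definition Lmat (p m l : nat) : 'M[R]_(l * p + l * m, p) :=
  col_mx (\matrix_(i < l * p, j < p) ((i : nat) == (l * p - p + j)%N)%:R) 0.

Definition Bmat (p m l : nat) : 'M[R]_(l * p + l * m, m) :=
  col_mx 0 (\matrix_(i < l * m, j < m) ((i : nat) == (l * m - m + j)%N)%:R).

Definition vnorm (d : nat) (v : 'cV[R]_d) : R :=
  Num.sqrt (\sum_(i < d) v i 0 ^+ 2).

Definition GAS (d : nat) (f : 'cV[R]_d -> 'cV[R]_d) : Prop :=
  f 0 = 0 /\
  (forall e : R, 0 < e -> exists2 delta : R, 0 < delta &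
     forall z0, vnorm z0 < delta -> forall k, vnorm (iter k f z0) < e) /\
  (forall z0 (e : R), 0 < e -> exists K : nat,
     forall k, (K <= k)%N -> vnorm (iter k f z0) < e).

End Defs.

(* Main.v *)
Require Import Defs.
From HB Require Import structures.
From mathcomp Require Import all_boot all_order all_algebra.
From mathcomp Require Import reals.
From mathcomp Require Import ring lra zify.
Import Order.TTheory GRing.Theory Num.Theory.
Local Open Scope ring_scope.

(** Observability gives the plant an ARX form y(k+l) = G psi(k), where psi(k) stacks the last
    l outputs and inputs. The controller state is a shift register, so after l steps it is
    psi and evolves by the matrix A = F + B K + L G. The true G is consistent with the data, so
    the noise bound yields the quadratic matrix inequality
      C + B G^T + G B^T + G A G^T <= 0   (script A, B, C).
    Congruence of the LMI with the block row [1, A, - L G] then leaves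
      P - A P A^T + L (C + B G^T + G B^T + G A G^T) L^T > 0,
    so P is a Lyapunov matrix for A^T and the powers of A vanish. The plant state is recovered
    from psi(k+l) by observability, hence it vanishes as well. *)

Set Implicit Arguments.
Unset Strict Implicit.

Definition qf {R : realType} {N} (M : 'M[R]_N) (v : 'cV[R]_N) : R := (v^T *m M *m v) 0 0.

(** * Real sequences tending to zero *)

Definition null {R : realType} (a : nat -> R) :=
  forall e : R, 0 < e -> exists K, forall k, (K <= k)%N -> `|a k| < e.

Section Null.
Variable R : realType.
Implicit Types (a b : nat -> R).

Lemma null_dominated c a b : (forall k, `|a k| <= c * `|b k|) -> null b -> null a.
Proof.
(* The sign of [c] is arbitrary; [|c| + 1] dominates it and is a positive divisor. *)
move=> ab b0 e e0; pose d := `|c| + 1.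
have d0 : 0 < d by rewrite ltr_wpDl.
have [K bK] := b0 _ (divr_gt0 e0 d0); exists K => k /bK bk.
rewrite (le_lt_trans (ab k))// (@le_lt_trans _ _ (d * `|b k|))//.
  by rewrite ler_wpM2r// (le_trans (ler_norm c))// lerDl.
by rewrite mulrC -ltr_pdivlMr.
Qed.

Lemma nullD a b : null a -> null b -> null (fun k => a k + b k).
Proof.
move=> a0 b0 e e0; have e2 : 0 < e / 2 by rewrite divr_gt0.
have [[K aK] [K' bK]] := (a0 _ e2, b0 _ e2).
exists (maxn K K') => k; rewrite geq_max => /andP[/aK ak /bK bk].
by rewrite (le_lt_trans (ler_normD _ _))// (splitr e) ltrD.
Qed.

Lemma null_sum (I : finType) (f : I -> nat -> R) :
  (forall i, null (f i)) -> null (fun k => \sum_i f i k).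
Proof.
move=> f0; elim: (index_enum I) => [|i s IH] e e0.
  by exists 0%N => k _; rewrite big_nil normr0.
have [K fK] := nullD (f0 i) IH e0.
by exists K => k /fK; rewrite big_cons.
Qed.

(** The tail is below 1, and the sum over the finitely many earlier terms bounds the rest. Applied
    to powers of a matrix, this gives the stability half of [GAS]. *)
Lemma null_bounded a : null a -> exists c, forall k, `|a k| <= c.
Proof.
move=> /(_ 1 ltr01)[K aK]; exists (1 + \sum_(i < K) `|a i|) => k.
have [/aK/ltW ak|kK] := leqP K k.
  by rewrite (le_trans ak)// lerDl sumr_ge0.
rewrite (bigD1 (Ordinal kK))//= addrCA lerDl addr_ge0// sumr_ge0//.
Qed.

(** Here [a k ^+ 2] decays at least like [D / k]; this is the rate that the Lyapunov argument
    provides. *)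
Lemma null_sqr_mul_nat a D : (forall k, k%:R * a k ^+ 2 <= D) -> null a.
Proof.
move=> aD e e0; have e2 : 0 < e ^+ 2 by rewrite exprn_gt0.
have D0 : 0 <= D by rewrite (le_trans _ (aD 0%N))// mul0r.
exists (Num.bound (D / e ^+ 2)) => k Kk.
rewrite ltNge; apply/negP => ek.
have := archi_boundP (divr_ge0 D0 (ltW e2)); rewrite ltr_pdivrMr// ltNge => /negP; apply.
rewrite (le_trans _ (aD k))// ler_pM ?ler_nat// ?sqr_ge0//.
by rewrite -(real_normK (num_real (a k))) lerXn2r ?nnegrE// ltW.
Qed.

Lemma null_shift l a : null (fun k => a (k + l)%N) -> null a.
Proof.
move=> al e e0; have [K aK] := al _ e0.
exists (K + l)%N => k Kk; have lk : (l <= k)%N by rewrite (leq_trans _ Kk)// leq_addl.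
by rewrite -(subnK lk) aK// leq_subRL// addnC.
Qed.

Lemma null_mulmxl m n q (D : 'M[R]_(m, n)) (M : nat -> 'M[R]_(n, q)) :
  (forall i j, null (fun k => M k i j)) -> forall i j, null (fun k => (D *m M k) i j).
Proof.
move=> M0 i j; have Dn l : null (fun k => D i l * M k l j).
  by apply: (null_dominated (c := `|D i l|)) (M0 l j) => k; rewrite normrM.
apply: (null_dominated (c := 1)) (null_sum Dn) => k.
by rewrite mxE mul1r.
Qed.

Lemma null_mulmxr m n q (M : nat -> 'M[R]_(m, n)) (D : 'M[R]_(n, q)) :
  (forall i j, null (fun k => M k i j)) -> forall i j, null (fun k => (M k *m D) i j).
Proof.
move=> M0 i j; apply: (null_dominated (c := 1) (b := fun k => (D^T *m (M k)^T) j i)).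
  by move=> k; rewrite mul1r -trmx_mul [X in _ <= `|X|]mxE.
apply: (@null_mulmxl _ _ _ _ (fun k => (M k)^T)) => a b.
by apply: (null_dominated (c := 1)) (M0 b a) => k; rewrite mxE mul1r.
Qed.

End Null.

(** * Quadratic forms of positive definite matrices *)

Section PD.
Variables (R : realType) (N : nat).
Implicit Types (P Q M : 'M[R]_N) (v w : 'cV[R]_N).

Lemma qfE M v : qf M v = \sum_i \sum_j v i 0 * M i j * v j 0.
Proof.
rewrite /qf mxE exchange_big/=; apply: eq_bigr => j _.
by rewrite mxE mulr_suml; apply: eq_bigr => i _; rewrite mxE.
Qed.

Lemma pdmx_unit P : pdmx P -> P \in unitmx.
Proof.
move=> [_ Ppos]; rewrite unitmxE unitfE; apply/det0P => -[v v0 vP].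
have v0' : v^T != 0 by rewrite -(inj_eq trmx_inj) trmxK trmx0.
by have := Ppos _ v0'; rewrite trmxK vP mul0mx mxE ltxx.
Qed.

Lemma qf_pd_ge0 P v : pdmx P -> 0 <= qf P v.
Proof.
move=> [_ Ppos]; have [->|/Ppos/ltW//] := eqVneq v 0.
by rewrite /qf mulmx0 mxE.
Qed.

(* Cauchy-Schwarz for the inner product of Q, applied to v and Q^-1 e_i. *)
Lemma pdmx_entry_bound Q : pdmx Q -> exists c : R, forall v i, v i 0 ^+ 2 <= c * qf Q v.
Proof.
move=> Qpd; have Qu := pdmx_unit Qpd; have [Qs _] := Qpd.
pose c i := (invmx Q) i i.
have Qis : (invmx Q)^T = invmx Q by rewrite trmx_inv Qs.
have key v i s : 0 <= qf Q v - s * v i 0 *+ 2 + s ^+ 2 * c i.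
  have [w Qw wi] : exists2 w : 'cV[R]_N, Q *m w = delta_mx i 0 & w i 0 = c i.
    by exists (invmx Q *m delta_mx i 0); rewrite ?mulKVmx// -colE mxE.
  have wQ : w^T *m Q = delta_mx 0 i.
    by rewrite -trmx_delta -Qw trmx_mul Qs.
  have := qf_pd_ge0 (v - s *: w) Qpd.
  have -> : qf Q (v - s *: w) = (v^T *m Q *m v - s *: (v^T *m delta_mx i 0)
      - s *: (delta_mx 0 i *m v) + (s * s) *: (delta_mx 0 i *m w)) 0 0.
    have vw : (v - s *: w)^T = v^T - s *: w^T by apply/matrixP => a b; rewrite !mxE.
    rewrite /qf vw !(mulmxBl, mulmxBr) -!scalemxAl -?scalemxAr -?scalemxAl wQ.
    rewrite -(mulmxA v^T Q w) Qw scalerA opprB addrA.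
    by rewrite addrAC [v^T *m Q *m v - _ - _]addrAC.
  rewrite -colE -!rowE !mxE wi.
  by rewrite [X in 0 <= X -> _](_ : _ = qf Q v - s * v i 0 *+ 2 + s ^+ 2 * c i)// /qf mxE; ring.
(* [c i] is the value of the form of [Q] at the nonzero vector [Q^-1 e_i]. *)
have c0 i : 0 < c i.
  have [_ /(_ (invmx Q *m delta_mx i 0))] := Qpd.
  rewrite trmx_mul Qis mulmxKV// -colE trmx_delta -rowE !mxE; apply.
  apply/negP => /eqP /(congr1 (mulmx Q)); rewrite colE mulKVmx// mulmx0 => /matrixP /(_ i 0).
  by rewrite !mxE !eqxx => /eqP; rewrite oner_eq0.
exists (\sum_i c i) => v i.
(* This value of [s] minimizes the quadratic polynomial in [key]. *)
have := key v i (v i 0 / c i).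
have -> : qf Q v - v i 0 / c i * v i 0 *+ 2 + (v i 0 / c i) ^+ 2 * c i = qf Q v - v i 0 ^+ 2 / c i.
  by field; rewrite gt_eqF.
rewrite subr_ge0 ler_pdivrMr// mulrC => /le_trans; apply.
rewrite ler_wpM2r ?qf_pd_ge0// (bigD1 i)//= lerDl sumr_ge0// => j _.
exact: ltW.
Qed.

(** Each product [|v_i| |v_j|] is at most the mean of the two squares, and the form of [Q] controls
    every square. *)
Lemma qf_le_pd P Q : pdmx Q -> exists2 t : R, 0 <= t & forall v, qf P v <= t * qf Q v.
Proof.
move=> Qpd; have [c vc] := pdmx_entry_bound Qpd.
pose d := `|c|; have vd v i : v i 0 ^+ 2 <= d * qf Q v.
  by rewrite (le_trans (vc v i))// ler_wpM2r ?qf_pd_ge0// ler_norm.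
exists (\sum_i \sum_j `|P i j| * d) => [|v].
  by apply: sumr_ge0 => i _; apply: sumr_ge0 => j _; rewrite mulr_ge0 ?normr_ge0.
rewrite qfE mulr_suml ler_sum// => i _; rewrite mulr_suml ler_sum// => j _.
have := ler_norm (v i 0 * P i j * v j 0); rewrite !normrM => /le_trans; apply.
rewrite -mulrA mulrCA -mulrA ler_wpM2l//.
have := vd v i; have := vd v j.
rewrite -(real_normK (num_real (v i 0))) -(real_normK (num_real (v j 0))).
have := sqr_ge0 (`|v i 0| - `|v j 0|); rewrite sqrrB.
by lra.
Qed.

End PD.

(** * Numerical positions in a vectorized matrix *)

Lemma index_allpairs (T1 T2 : eqType) (s : seq T1) (t : seq T2) i j :
  i \in s -> j \in t ->
  index (i, j) [seq (a, b) | a <- s, b <- t] = (index i s * size t + index j t)%N.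
Proof.
move=> si tj; elim: s si => //= a s IH; rewrite inE index_cat eq_sym.
have [->|ai] /= := eqVneq a i.
  by rewrite map_f// index_map// => u v [].
move=> /IH ->; rewrite ifF ?size_map ?mulSn ?addnA//.
by apply/negP => /mapP[b _ [/eqP]]; rewrite eq_sym (negPf ai).
Qed.

(** Pairs are enumerated row by row. This links [stack], built on [mxvec], to [shift_mx], [Lmat] and
    [Bmat], whose entries are given by numerical positions. *)
Lemma val_mxvec_index m n (i : 'I_m) (j : 'I_n) : mxvec_index i j = (i * n + j)%N :> nat.
Proof.
rewrite /= /enum_rank enum_rank_in.unlock insubdK.
  rewrite enumT unlock /= index_allpairs ?mem_enum//.
  by rewrite !index_enum_ord size_enum_ord.
by rewrite unfold_in cardE index_mem mem_enum.
Qed.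

(** * Lyapunov stability of discrete-time linear maps *)

Section Stab.
Variables (R : realType).

Lemma trmx_exp N (A : 'M[R]_N) k : (A ^+ k)^T = A^T ^+ k.
Proof. by elim: k => [|k IH]; rewrite ?trmx1// exprS exprSr -!mulmxE trmx_mul IH. Qed.

(** The form of [P] is a Lyapunov function of the map [A^T], whose iterates of [e_i] are the
    transposed rows [i] of the powers of [A]. *)
Lemma null_expmx N (A P : 'M[R]_N) : pdmx P -> pdmx (P - A *m P *m A^T) ->
  forall i j, null (fun k => (A ^+ k) i j).
Proof.
move=> Ppd Qpd i j; set Q := P - _ in Qpd.
have [t t0 PQ] := qf_le_pd P Qpd.
have [c vc] := pdmx_entry_bound Ppd.
pose w k : 'cV[R]_N := (A^T) ^+ k *m delta_mx i 0.
have VQ k : qf P (w k.+1) = qf P (w k) - qf Q (w k).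
  rewrite /w exprS -mulmxE -mulmxA -/(w k); move: (w k) => v.
  have -> : qf Q v = qf P v - qf (A *m P *m A^T) v by rewrite /qf /Q mulmxBr mulmxBl !mxE.
  by rewrite opprB addrC subrK /qf trmx_mul trmxK !mulmxA.
(* As V(k+1) <= V(k) and V(k) <= t (V(k) - V(k+1)), the sequence (k + t) V(k) does not increase. *)
have Vle k : (k%:R + t) * qf P (w k) <= t * qf P (w 0%N).
  elim: k => [|k IH]; first by rewrite add0r.
  rewrite (le_trans _ IH)// -natr1.
  have := PQ (w k); have := VQ k; have := qf_pd_ge0 (w k) Qpd.
  have := ler0n R k; have := qf_pd_ge0 (w k.+1) Ppd => *; nra.
apply: (null_sqr_mul_nat (D := `|c| * (t * qf P (w 0%N)))) => k.
have -> : (A ^+ k) i j = w k j 0 by rewrite /w -colE -trmx_exp !mxE.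
rewrite (@le_trans _ _ (`|c| * (k%:R * qf P (w k))))//.
  rewrite [leRHS]mulrCA ler_wpM2l// (le_trans (vc _ _))// ler_wpM2r ?ler_norm//.
  exact: qf_pd_ge0.
rewrite ler_wpM2l// (le_trans _ (Vle k))// ler_wpM2r ?lerDl//.
exact: qf_pd_ge0.
Qed.

Lemma iter_mulmx N (Z : 'M[R]_N) k v : iter k (fun z : 'cV[R]_N => Z *m z) v = Z ^+ k *m v.
Proof. by elim: k => [|k IH]; rewrite ?mul1mx//= IH exprS -mulmxE mulmxA. Qed.

Lemma le_entry_vnorm N (v : 'cV[R]_N) i : `|v i 0| <= vnorm v.
Proof.
rewrite -sqrtr_sqr ler_wsqrtr// (bigD1 i)//= lerDl sumr_ge0// => j _; exact: sqr_ge0.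
Qed.

Lemma vnorm_le_sum N (v : 'cV[R]_N) : vnorm v <= \sum_i `|v i 0|.
Proof.
have s0 : 0 <= \sum_i `|v i 0| by exact: sumr_ge0.
rewrite -(ger0_norm s0) -sqrtr_sqr ler_wsqrtr// expr2 mulr_suml ler_sum// => i _.
by rewrite -real_normK ?num_real// expr2 ler_wpM2l// (bigD1 i)//= lerDl sumr_ge0.
Qed.

(** Vanishing powers are bounded, which gives stability; applied to a fixed initial vector they
    vanish, which gives attraction. *)
Lemma GAS_linear N (Z : 'M[R]_N) :
  (forall i j, null (fun k => (Z ^+ k) i j)) -> GAS (fun z => Z *m z).
Proof.
move=> Z0; split; first by rewrite mulmx0.
split=> [e e0|z0 e e0].
- have [b Zb] : exists b : 'I_N -> 'I_N -> R, forall i j k, `|(Z ^+ k) i j| <= b i j.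
    have [b bZ] := fin_all_exists (fun i => fin_all_exists (fun j => null_bounded (Z0 i j))).
    by exists b.
  pose c := \sum_i \sum_j `|b i j|; have c0 : 0 <= c by do 2 apply: sumr_ge0 => ? _.
  (* [c] may be zero, hence the added 1. *)
  exists (e / (c + 1)) => [|z zd k]; first by rewrite divr_gt0// ltr_wpDl.
  rewrite iter_mulmx (le_lt_trans (vnorm_le_sum _))//.
  rewrite (@le_lt_trans _ _ (c * vnorm z))//.
    rewrite mulr_suml ler_sum// => i _; rewrite mxE (le_trans (ler_norm_sum _ _ _))//.
    rewrite mulr_suml ler_sum// => j _; rewrite normrM ler_pM ?le_entry_vnorm//.
    by rewrite (le_trans (Zb _ _ _))// ler_norm.
  have c1 : 0 < c + 1 by rewrite ltr_wpDl.
  rewrite (@le_lt_trans _ _ ((c + 1) * vnorm z))//.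
    by rewrite ler_wpM2r ?sqrtr_ge0// lerDl.
  by rewrite mulrC -ltr_pdivlMr.
- have z_null i : null (fun k => `|(Z ^+ k *m z0) i 0|).
    apply: (null_dominated (c := 1)) (null_mulmxr z0 Z0 i 0) => k.
    by rewrite normr_id mul1r.
  have [K HK] := null_sum z_null e0; exists K => k /HK; rewrite iter_mulmx.
  by apply: le_lt_trans; rewrite (le_trans (vnorm_le_sum _))// ler_norm.
Qed.

End Stab.

(** * Block selection, shift registers and the ARX form *)

Section Sel.
Variables (R : realType).

(** Left multiplication reads block [t] of a stacked vector. The index is an unbounded number, so a
    block shifted out of range is the zero matrix. *)
Definition sel l q t : 'M[R]_(q, l * q) := \matrix_(a, k) ((k : nat) == (t * q + a)%N)%:R.
(** The nonzero block of [Lmat] and of [Bmat]. *)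
Definition last_block l q : 'M[R]_(l * q, q) :=
  \matrix_(i, j) ((i : nat) == (l * q - q + j)%N)%:R.

Lemma sel_mulE l q r t (tl : (t < l)%N) (M : 'M[R]_(l * q, r)) a j :
  (sel l q t *m M) a j = M (mxvec_index (Ordinal tl) a) j.
Proof.
rewrite mxE (bigD1 (mxvec_index (Ordinal tl) a))//= mxE val_mxvec_index eqxx mul1r.
rewrite big1 ?addr0// => k; rewrite mxE -val_eqE [_ == val _]/= [X in _ == X]val_mxvec_index /=.
by move=> /negPf ->; rewrite mul0r.
Qed.

Lemma sel_stack l q t (f : nat -> 'cV[R]_q) : (t < l)%N ->
  sel l q t *m stack (fun i : 'I_l => f i) = f t.
Proof.
by move=> tl; apply/colP => a; rewrite (sel_mulE tl) mxE mxvecE mxE.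
Qed.

Lemma sel_shift l q t : (t < l)%N -> sel l q t *m shift_mx R q l = sel l q t.+1.
Proof.
move=> tl; apply/matrixP => a j; rewrite (sel_mulE tl) !mxE val_mxvec_index /=.
by rewrite addnAC [(t * q + q)%N]addnC -mulSn.
Qed.

Lemma sel_out l q t : (l <= t)%N -> sel l q t = 0.
Proof.
move=> lt; apply/matrixP => a j; rewrite !mxE; case: eqP => // jt.
by have := ltn_ord j; rewrite jt ltnNge (leq_trans _ (leq_addr _ _))// leq_mul2r lt orbT.
Qed.

Lemma sel_last_block l q t : (t < l)%N ->
  sel l q t *m last_block l q = (t.+1 == l)%:R%:M.
Proof.
move=> tl; apply/matrixP => a j; rewrite (sel_mulE tl) !mxE val_mxvec_index /=.
have -> : (l * q - q = l.-1 * q)%N by rewrite -[l in LHS](ltn_predK tl) mulSn addKn.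
have [tl1|tl1] := eqVneq t.+1 l; first by rewrite -tl1 /= eqn_add2l -val_eqE mulrb.
rewrite mul0rn; case: eqP => // E.
(* Block [t] ends before the last block begins, so equal positions would force [q <= a]. *)
have : (t.+1 * q <= l.-1 * q + j)%N.
  by rewrite (leq_trans _ (leq_addr _ _))// leq_mul2r; apply/orP; right; lia.
by rewrite -E mulSn addnC leq_add2l leqNgt ltn_ord.
Qed.

Lemma tr_last_block l q : (0 < l)%N -> (last_block l q)^T = sel l q l.-1.
Proof.
move=> l0; apply/matrixP => a j; rewrite !mxE.
by have -> : (l * q - q = l.-1 * q)%N by rewrite -[l in LHS](prednK l0) mulSn addKn.
Qed.

Lemma sel_ext l q r (v w : 'M[R]_(l * q, r)) :
  (forall t, (t < l)%N -> sel l q t *m v = sel l q t *m w) -> v = w.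
Proof.
move=> vw; apply/matrixP => i j; case/mxvec_indexP: i => -[t tl] a.
by rewrite -!sel_mulE vw.
Qed.

(** Each step drops the oldest block, moves the others one place towards the front and writes the
    new sample last, so initial contents are gone after [l] steps. *)
Lemma shift_register l q (v : nat -> 'cV[R]_(l * q)) (y : nat -> 'cV[R]_q) :
  (forall k, v k.+1 = shift_mx R q l *m v k + last_block l q *m y k) ->
  forall k, (l <= k)%N -> v k = stack (fun i : 'I_l => y (k - l + i)%N).
Proof.
(* The register fills from its end: block [t] is already known once [l <= k + t], which is what the
   induction on [k] carries. *)
move=> vS; have vy k : forall t, (t < l)%N -> (l <= k + t)%N -> sel l q t *m v k = y (k + t - l)%N.
  elim: k => [|k IH] t tl lt; first by rewrite leqNgt tl in lt.
  rewrite vS mulmxDr !mulmxA sel_shift// sel_last_block//.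
  have [tl1|tl1] := eqVneq t.+1 l.
    by rewrite sel_out ?tl1// mul0mx add0r mul1mx; congr (y _); lia.
  by rewrite mul_scalar_mx scale0r addr0 IH; [congr (y _); lia | lia | lia].
move=> k lk; apply: sel_ext => t tl; rewrite (sel_stack (fun i => y (k - l + i)%N))//.
by rewrite vy// ?(leq_trans lk) ?leq_addr// addnBAC.
Qed.

(* Observability turns a window of outputs and inputs into the state that produced it,
   hence into the next output: this is the ARX form y(k + l) = G psi(k) of the plant. *)
Lemma state_from_window n m p l (A : 'M[R]_n) (B : 'M[R]_(n, m)) (C : 'M[R]_(p, n)) :
  \rank (obs_mx C A l) = n ->
  exists (W : 'M[R]_(n, l * p + l * m)) (G : 'M[R]_(p, l * p + l * m)),
  forall x u y,
    (forall k, (k < l)%N -> x k.+1 = A *m x k + B *m u k) ->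
    (forall k, (k <= l)%N -> y k = C *m x k) ->
    let psi := col_mx (stack (fun i : 'I_l => y i)) (stack (fun i : 'I_l => u i)) in
    x 0%N = W *m psi /\ y l = G *m psi.
Proof.
move=> /eqP/row_fullP[D DO].
(* [H t] sends the window to the contribution of the inputs to the state at time [t]. *)
pose H := fix H t : 'M[R]_(n, l * p + l * m) :=
  if t is t'.+1 then A *m H t' + B *m row_mx 0 (sel l m t') else 0.
(* Removing the input contribution from output [i] leaves [C A^i x(0)]; the left inverse [D] of the
   observability matrix then returns [x(0)]. *)
pose W := \sum_(i < l) submxrow D i *m (row_mx (sel l p i) 0 - C *m H i).
exists W, (C *m (A ^+ l *m W + H l)) => x u y xS yC psi.
have xt t : (t <= l)%N -> x t = A ^+ t *m x 0%N + H t *m psi.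
  elim: t => [|t IH] tl; first by rewrite mul1mx mul0mx addr0.
  rewrite xS// IH 1?ltnW// mulmxDr exprS -mulmxE /= mulmxDl !mulmxA -addrA.
  by congr (_ + (_ + _)); rewrite -[RHS]mulmxA mul_row_col mul0mx add0r sel_stack.
have x0 : x 0%N = W *m psi.
  rewrite -[LHS]mul1mx -DO -[D]submxrowK mul_mxrow_mxcol !mulmx_suml.
  apply: eq_bigr => i _; rewrite -!mulmxA; congr (_ *m _).
  rewrite mulmxBl mul_row_col mul0mx addr0 (sel_stack y)// yC 1?ltnW// (xt i) 1?ltnW//.
  by rewrite mulmxDr !mulmxA addrK.
by split=> //; rewrite yC// (xt l)// x0 -!mulmxA mulmxDl -!mulmxA.
Qed.

End Sel.

(* The products are abstracted with ssreflect's [move:] because [generalize] misses occurrences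
   that differ in the path of the inferred ring structure. *)
Ltac mx_abel :=
  rewrite ?(mulmxDl, mulmxDr, mulmxBl, mulmxBr, mulmxN, mulNmx, mul1mx, mulmx1) ?mulmxA;
  repeat match goal with |- context [@mulmx ?S ?m ?n ?p ?a ?b] =>
    let h := fresh "h" in move: (@mulmx S m n p a b) => h end;
  intros; apply/matrixP => ? ?; rewrite !mxE; ring.

(** * From noisy data and the LMI to a Lyapunov inequality *)

Section LMI.
Variables (R : realType).

Lemma trmxB m n (A B : 'M[R]_(m, n)) : (A - B)^T = A^T - B^T.
Proof. by apply/matrixP => i j; rewrite !mxE. Qed.

Lemma trmxN m n (A : 'M[R]_(m, n)) : (- A)^T = - A^T.
Proof. by apply/matrixP => i j; rewrite !mxE. Qed.

(** With [S = [1, -G]] the residual [M1 - G *m M0] is [S *m Delta], and the quadratic expression in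
    [G] equals [- S (Theta - Delta Delta^T) S^T]. *)
Lemma consistent_qmi N p q (M1 : 'M[R]_(p, q)) (M0 : 'M[R]_(N, q)) (G : 'M[R]_(p, N))
    (Theta : 'M[R]_(p + N)) (Delta : 'M[R]_(p + N, q)) :
  let sA := M0 *m M0^T - drsubmx Theta in
  let sB := - (M1 *m M0^T) + ursubmx Theta in
  let sC := M1 *m M1^T - ulsubmx Theta in
  Theta^T = Theta -> psdmx (Theta - Delta *m Delta^T) ->
  M1 - G *m M0 = row_mx 1%:M (- G) *m Delta ->
  forall v, qf (sC + sB *m G^T + G *m sB^T + G *m sA *m G^T) v <= 0.
Proof.
move=> sA sB sC ThetaS [_ Dpsd] E v.
set X := sC + _ + _ + _; pose S := row_mx 1%:M (- G).
have Tdl : dlsubmx Theta = (ursubmx Theta)^T by rewrite trmx_ursub ThetaS.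
have STS : S *m Theta *m S^T = ulsubmx Theta - G *m (ursubmx Theta)^T
    - ursubmx Theta *m G^T + G *m drsubmx Theta *m G^T.
  rewrite -{1}(submxK Theta) Tdl mul_row_block tr_row_mx mul_row_col trmx1 trmxN.
  by mx_abel.
have XE : X = - (S *m (Theta - Delta *m Delta^T) *m S^T).
  rewrite mulmxBr mulmxBl STS.
  have -> : S *m (Delta *m Delta^T) *m S^T = (M1 - G *m M0) *m (M1 - G *m M0)^T.
    by rewrite E trmx_mul !mulmxA.
  have -> : (M1 - G *m M0)^T = M1^T - M0^T *m G^T by rewrite trmxB trmx_mul.
  have sBT : sB^T = (ursubmx Theta)^T - M0 *m M1^T by rewrite /sB addrC trmxB trmx_mul trmxK.
  by rewrite /X sBT /sA /sB /sC; mx_abel.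
rewrite /qf XE mulmxN mulNmx mxE oppr_le0.
by have := Dpsd (S^T *m v); rewrite trmx_mul trmxK !mulmxA.
Qed.

Lemma lmi_lyapunov N p (P H sA : 'M[R]_N) (L : 'M[R]_(N, p)) (sB G : 'M[R]_(p, N)) sC :
  let A := H + L *m G in
  P^T = P ->
  pdmx (- block_mx (block_mx (- P - L *m sC *m L^T) (H *m P) (P *m H^T) (- P))
           (col_mx (L *m sB) (- P)) (row_mx (sB^T *m L^T) (- P)) (- sA)) ->
  (forall w, qf (sC + sB *m G^T + G *m sB^T + G *m sA *m G^T) (L^T *m w) <= 0) ->
  pdmx (P - A *m P *m A^T).
Proof.
move=> A Ps [_ Mpos] Xneg; set M := - _ in Mpos; set X := _ + _ in Xneg.
split=> [|w w0]; first by rewrite trmxB !trmx_mul trmxK Ps mulmxA.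
(* Since [H + L *m G = A], the last two blocks merge the cross terms into [A P A^T] and gather the
   data terms into [L X L^T]. *)
pose S := row_mx (row_mx 1%:M A) (- (L *m G)).
have SMS : S *m M *m S^T = P - A *m P *m A^T + L *m X *m L^T.
  rewrite /S /M mulmxN mulNmx.
  rewrite mul_row_block mul_row_block !mul_row_col !tr_row_mx !mul_row_col mul_mx_row.
  rewrite add_row_mx mul_row_col trmxN !trmx_mul trmx1.
  have -> : A^T = H^T + G^T *m L^T by rewrite raddfD /= trmx_mul.
  by rewrite /X /A; mx_abel.
(* The identity block of [S] makes [w] the first block of [S^T *m w], so strictness survives the
   congruence. *)
have v0 : S^T *m w != 0.
  apply/negP => /eqP; rewrite !tr_row_mx !mul_col_mx trmx1 mul1mx => /(congr1 (usubmx \o usubmx)).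
  by rewrite /= !col_mxKu !linear0 => /eqP; apply/negP.
have -> : w^T *m (P - A *m P *m A^T) *m w =
    (S^T *m w)^T *m M *m (S^T *m w) - w^T *m (L *m X *m L^T) *m w.
  by rewrite trmx_mul trmxK -[P - _](addrK (L *m X *m L^T)) -SMS mulmxBr mulmxBl !mulmxA.
have Xw : (w^T *m (L *m X *m L^T) *m w) 0 0 <= 0.
  by have := Xneg w; rewrite /qf trmx_mul trmxK !mulmxA.
by rewrite mxE [X in _ + X]mxE; apply: ltr_wpDr; rewrite ?oppr_ge0// Mpos.
Qed.

End LMI.

(** * The closed loop *)

Section Loop.
Variables (R : realType).

Lemma eq_stack l q (f g : 'I_l -> 'cV[R]_q) : f =1 g -> stack f = stack g.
Proof. by move=> fg; rewrite /stack; congr (mxvec _)^T; apply/matrixP => i a; rewrite !mxE fg. Qed.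

Lemma stackD l q (f g : 'I_l -> 'cV[R]_q) : stack (fun i => f i + g i) = stack f + stack g.
Proof.
rewrite /stack -raddfD -linearD /=; congr (mxvec _)^T.
by apply/matrixP => i a; rewrite !mxE.
Qed.

Lemma mulmx_mk_cols a b N (D : 'M[R]_(a, b)) (f : 'I_N -> 'cV[R]_b) :
  D *m mk_cols f = mk_cols (fun j => D *m f j).
Proof. by apply/matrixP => i j; rewrite !mxE; apply: eq_bigr => k _; rewrite mxE. Qed.

Lemma mk_colsB a N (f g : 'I_N -> 'cV[R]_a) :
  mk_cols f - mk_cols g = mk_cols (fun j => f j - g j).
Proof. by apply/matrixP => i j; rewrite !mxE. Qed.

Lemma eq_mk_cols a N (f g : 'I_N -> 'cV[R]_a) : f =1 g -> mk_cols f = mk_cols g.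
Proof. by move=> fg; apply/matrixP => i j; rewrite !mxE fg. Qed.

(** As [u = K chi], the controller splits into two shift registers, one fed with [y] through [Lmat],
    the other with [u] through [Bmat]. *)
Lemma closed_loop_memory m p l K
    (chi : nat -> 'cV[R]_(l * p + l * m)) (u : nat -> 'cV[R]_m) (y : nat -> 'cV[R]_p) :
  (forall k, chi k.+1 = (Fmat R p m l + Bmat R p m l *m K) *m chi k + Lmat R p m l *m y k) ->
  (forall k, u k = K *m chi k) ->
  forall k, (l <= k)%N ->
    chi k = col_mx (stack (fun i : 'I_l => y (k - l + i)%N))
                   (stack (fun i : 'I_l => u (k - l + i)%N)).
Proof.
move=> chiS uK k lk.
have step j : chi j.+1 = col_mx (shift_mx R p l *m usubmx (chi j) + last_block R l p *m y j)
    (shift_mx R m l *m dsubmx (chi j) + last_block R l m *m u j).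
  rewrite chiS mulmxDl -mulmxA -uK -{1}[chi j]vsubmxK mul_block_col !mul_col_mx !mul0mx.
  by rewrite !add_col_mx !addr0 !add0r.
rewrite -[LHS]vsubmxK; congr col_mx.
  by apply: (shift_register (v := fun j => usubmx (chi j))) => // j; rewrite step col_mxKu.
by apply: (shift_register (v := fun j => dsubmx (chi j))) => // j; rewrite step col_mxKd.
Qed.

(** From time [l] on, [chi] is a genuine window of the plant, so [y = G chi] and [chi] evolves by
    [F + Bl *m K + L *m G] alone. The plant state is a linear image of a later [chi]. *)
Lemma closed_loop_GAS n m p l (A : 'M[R]_n) (B : 'M[R]_(n, m)) (C : 'M[R]_(p, n)) K W G :
  (forall x u y,
    (forall k, (k < l)%N -> x k.+1 = A *m x k + B *m u k) ->
    (forall k, (k <= l)%N -> y k = C *m x k) ->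
    let psi := col_mx (stack (fun i : 'I_l => y i)) (stack (fun i : 'I_l => u i)) in
    x 0%N = W *m psi /\ y l = G *m psi) ->
  let F := Fmat R p m l in let Bl := Bmat R p m l in let L := Lmat R p m l in
  (forall i j, null (fun k => ((F + Bl *m K + L *m G) ^+ k) i j)) ->
  GAS (fun z => block_mx A (B *m K) (L *m C) (F + Bl *m K) *m z).
Proof.
move=> win F Bl L powA; set Z := block_mx _ _ _ _; apply: GAS_linear => i j.
(* Column [j] of the powers of [Z] is the closed-loop trajectory started at [e_j]. *)
pose z k := Z ^+ k *m (delta_mx j 0 : 'cV_ _).
apply: (null_dominated (c := 1) (b := fun k => z k i 0)) => [k|].
  by rewrite /z -colE [X in _ <= _ * `|X|]mxE mul1r.
pose x k := usubmx (z k); pose chi k := dsubmx (z k).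
pose u k := K *m chi k; pose y k := C *m x k.
have zS k : z k.+1 = col_mx (A *m x k + B *m u k) ((F + Bl *m K) *m chi k + L *m y k).
  rewrite /z exprS -mulmxE -mulmxA -/(z k) -[z k]vsubmxK mul_block_col -!mulmxA.
  by rewrite [L *m _ + _]addrC.
have xS k : x k.+1 = A *m x k + B *m u k by rewrite /x zS col_mxKu.
have chiS k : chi k.+1 = (F + Bl *m K) *m chi k + L *m y k by rewrite /chi zS col_mxKd.
(* The controller state at time [k + l] records the window that starts at [k], hence gives the state
   at [k] and the output at [k + l]. *)
have mem k : x k = W *m chi (k + l)%N /\ y (k + l)%N = G *m chi (k + l)%N.
  have -> : chi (k + l)%N = col_mx (stack (fun i : 'I_l => y (k + i)%N))
                                   (stack (fun i : 'I_l => u (k + i)%N)).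
    by rewrite (closed_loop_memory chiS (fun=> erefl)) ?leq_addl// addnK.
  have [] := win (fun t => x (k + t)%N) (fun t => u (k + t)%N) (fun t => y (k + t)%N).
  - by move=> t _; rewrite addnS xS.
  - by [].
  - by rewrite addn0 => -> ->.
have chil k : chi (k + l)%N = (F + Bl *m K + L *m G) ^+ k *m chi l.
  elim: k => [|k IH]; first by rewrite mul1mx.
  by rewrite addSn chiS (mem k).2 mulmxA -mulmxDl IH mulmxA exprS -mulmxE.
have chil0 : forall i j, null (fun k => chi (k + l)%N i j).
  move=> a b; apply: (null_dominated (c := 1)) (null_mulmxr (chi l) powA a b) => k.
  by rewrite mul1r -chil.
have zE k : z k = col_mx (x k) (chi k) by rewrite vsubmxK.
case: (split_ordP i) => a ->.
  apply: (null_dominated (c := 1)) (null_mulmxl W chil0 a 0) => k.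
  by rewrite mul1r zE col_mxEu (mem k).1.
apply: (@null_shift _ l); apply: (null_dominated (c := 1)) (chil0 a 0) => k.
by rewrite mul1r zE col_mxEd.
Qed.

End Loop.

(** * The data-driven controller *)

Theorem theorem1 (R : realType) (n m p : nat)
  (As : 'M[R]_n) (Bs : 'M[R]_(n, m)) (Cs : 'M[R]_(p, n))
  (hobs : observable As Cs) (ell : nat) (hell : obs_index As Cs ell)
  (T : nat) (hT : (ell <= T)%N)
  (x : nat -> 'cV[R]_n) (u : nat -> 'cV[R]_m) (y : nat -> 'cV[R]_p)
  (du : nat -> 'cV[R]_m) (dy : nat -> 'cV[R]_p)
  (um : nat -> 'cV[R]_m) (ym : nat -> 'cV[R]_p)
  (hx : forall k, (k <= T)%N -> x k.+1 = As *m x k + Bs *m u k)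
  (hy : forall k, (k <= T)%N -> y k = Cs *m x k)
  (hum : forall k, (k <= T)%N -> um k = u k + du k)
  (hym : forall k, (k <= T)%N -> ym k = y k + dy k)
  (Theta : 'M[R]_(p + (ell * p + ell * m)))
  (hTheta : psdmx Theta)
  (Y : 'M[R]_(m, ell * p + ell * m)) (P : 'M[R]_(ell * p + ell * m)) :
  let N := (ell * p + ell * m)%N in
  let Psi1 : 'M[R]_(N, T - ell + 1) := mk_cols (fun j : 'I_(T - ell + 1) =>
      col_mx (stack (fun i : 'I_ell => ym (j + 1 + i)%N))
             (stack (fun i : 'I_ell => um (j + 1 + i)%N))) in
  let Psi0 : 'M[R]_(N, T - ell + 1) := mk_cols (fun j : 'I_(T - ell + 1) =>
      col_mx (stack (fun i : 'I_ell => ym (j + i)%N))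
             (stack (fun i : 'I_ell => um (j + i)%N))) in
  let Delta10 : 'M[R]_(p + N, T - ell + 1) := mk_cols (fun j : 'I_(T - ell + 1) =>
      col_mx (dy (j + ell)%N)
        (col_mx (stack (fun i : 'I_ell => dy (j + i)%N))
                (stack (fun i : 'I_ell => du (j + i)%N)))) in
  let Theta11 : 'M[R]_p := ulsubmx Theta in
  let Theta12 : 'M[R]_(p, N) := ursubmx Theta in
  let Theta22 : 'M[R]_N := drsubmx Theta in
  let F := @Fmat R p m ell in
  let L := @Lmat R p m ell in
  let Bl := @Bmat R p m ell in
  let sA : 'M[R]_N := Psi0 *m Psi0^T - Theta22 in
  let sB : 'M[R]_(p, N) := - (L^T *m Psi1 *m Psi0^T) + Theta12 in
  let sC : 'M[R]_p := L^T *m Psi1 *m Psi1^T *m L - Theta11 in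
  psdmx (Theta - Delta10 *m Delta10^T) ->
  pdmx (Psi0 *m Psi0^T - Theta22) ->
  pdmx P ->
  pdmx (- block_mx
           (block_mx (- P - L *m sC *m L^T) (F *m P + Bl *m Y)
                     (P *m F^T + Y^T *m Bl^T) (- P))
           (col_mx (L *m sB) (- P))
           (row_mx (sB^T *m L^T) (- P))
           (- sA)) ->
  let K : 'M[R]_(m, N) := Y *m invmx P in
  GAS (fun z : 'cV[R]_(n + N) =>
         block_mx As (Bs *m K) (L *m Cs) (F + Bl *m K) *m z)
  /\
  (forall (xs : nat -> 'cV[R]_n) (chi : nat -> 'cV[R]_N)
          (us : nat -> 'cV[R]_m) (ys : nat -> 'cV[R]_p),
     (forall k, xs k.+1 = As *m xs k + Bs *m us k) ->
     (forall k, ys k = Cs *m xs k) ->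
     (forall k, chi k.+1 = (F + Bl *m K) *m chi k + L *m ys k) ->
     (forall k, us k = K *m chi k) ->
     forall k, (ell <= k)%N ->
       chi k = col_mx (stack (fun i : 'I_ell => ys (k - ell + i)%N))
                      (stack (fun i : 'I_ell => us (k - ell + i)%N))).
Proof.
move=> N Psi1 Psi0 Delta10 Theta11 Theta12 Theta22 F L Bl sA sB sC noise _ Ppd lmi K.
have [W [G win]] := state_from_window Bs hell.1.
split; last by move=> xs chi us ys _ _; exact: closed_loop_memory _ _ _ _.
apply: (closed_loop_GAS win); apply: (null_expmx Ppd).
have Pu := pdmx_unit Ppd; have [Ps _] := Ppd.
(* Undoing the substitution [Y = K P] exposes [F + Bl *m K] in the matrix inequality. *)
have KP : K *m P = Y by rewrite mulmxKV.
have HP : F *m P + Bl *m Y = (F + Bl *m K) *m P by rewrite mulmxDl -mulmxA KP.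
have PH : P *m F^T + Y^T *m Bl^T = P *m (F + Bl *m K)^T.
  by have := congr1 trmx HP; rewrite raddfD /= !trmx_mul Ps.
rewrite HP PH in lmi.
apply: lmi_lyapunov Ps lmi _ => w.
(* If [ell = 0] the register is empty and has no last block to read; every vector of size [N] is
   then zero. *)
have [l0|l0] := posnP ell.
  suff -> : w = 0 by rewrite /qf !mulmx0 mxE.
  have N0 : N = 0%N by rewrite /N l0.
  by apply/colP => -[i iN]; have := iN; rewrite -/N [X in (i < X)%N]N0.
have LT : L^T = row_mx (sel R ell p ell.-1) 0 by rewrite /L /Lmat tr_col_mx tr_last_block// trmx0.
(* [L^T] reads the newest output [ym (j + ell)] in column [j]. Measured windows are true windows
   plus noise windows, and the true parts cancel by the ARX form. *)
have E : L^T *m Psi1 - G *m Psi0 = row_mx 1%:M (- G) *m Delta10.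
  rewrite !mulmx_mk_cols mk_colsB; apply: eq_mk_cols => j /=.
  (* Column indices satisfy [j <= T - ell], so the times from [j] to [j + ell] all lie in the data
     record. *)
  have jT i : (i <= ell)%N -> (j + i <= T)%N by have := ltn_ord j; lia.
  rewrite LT mul_row_col mul0mx addr0.
  rewrite (sel_stack (fun i => ym (j + 1 + i)%N)) ?prednK//.
  have -> : (j + 1 + ell.-1 = j + ell)%N by lia.
  have -> : col_mx (stack (fun i : 'I_ell => ym (j + i)%N)) (stack (fun i : 'I_ell => um (j + i)%N))
    = col_mx (stack (fun i : 'I_ell => y (j + i)%N)) (stack (fun i : 'I_ell => u (j + i)%N))
    + col_mx (stack (fun i : 'I_ell => dy (j + i)%N)) (stack (fun i : 'I_ell => du (j + i)%N)).
    rewrite add_col_mx -!stackD; congr col_mx; apply: eq_stack => i.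
      by rewrite hym// jT// ltnW.
    by rewrite hum// jT// ltnW.
  have [] := win (fun t => x (j + t)%N) (fun t => u (j + t)%N) (fun t => y (j + t)%N).
  - by move=> t tl; rewrite addnS hx// jT// ltnW.
  - by move=> t tl; rewrite hy// jT.
  move=> _ yl; rewrite hym ?jT// yl mulmxDr mul_row_col mul1mx mulNmx.
  by rewrite opprD addrACA subrr add0r.
have := consistent_qmi hTheta.1 noise E (L^T *m w).
by rewrite trmx_mul trmxK !mulmxA.
Qed.
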